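(* Let $\langle N,\{v(t)\}\rangle$ be a dynamic TU game with $N=\{1,\dots,n\}$, where each $v(t)\in\mathbb{R}^m$, $m=2^n-1$, $t=0,1,2,\dots$, is a random vector. Assume the following. (1) There exists $v^{\max}\in\mathbb{R}^m$ such that for all $t\ge 0$, $v_N(t)=v_N^{\max}$ and $v_S(t)\le v_S^{\max}$ for all nonempty coalitions $S\subsetneq N$. (2) The core $C(v^{\max})$ is not empty. (3) Each weight matrix $A(t)=[a_{ij}(t)]$ is doubly stochastic with positive diagonal, and there exists a scalar $\alpha>0$ such that $a_{ij}(t)\ge\alpha$ whenever $a_{ij}(t)>0$. (4) There is an integer $Q\ge 1$ such that the directed graph $\left(N,\bigcup_{\tau=tQ}^{(t+1)Q-1}\mathcal{E}(\tau)\right)$ is strongly connected for every $t\ge 0$. (5) $\mathrm{Prob}\{v(t)=v^{\max}\ \text{for infinitely many } t\}=1$. Let the allocations $x^i(t)$, $i\in N$, $t\ge 0$, be generated by the bargaining protocol $$x^i(t+1)=P_{X_i(t)}\Big[\sum_{j=1}^n a_{ij}(t)x^j(t)\Big]\qquad\text{for all } i\in N,\ t\ge 0.$$ Then the allocations converge with probability 1 to an allocation in the core $C(v^{\max})$, i.e., there is a random vector $\tilde x\in C(v^{\max})$ such that with probability 1, $$\lim_{t\to\infty}\|x^i(t)-\tilde x\|=0\qquad\text{for all } i\in N.$$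
   Context: Characteristic functions are viewed as vectors $\eta\in\mathbb{R}^m$ indexed by the nonempty coalitions $S\subseteq N=\{1,\dots,n\}$, with $\eta_S$ the value of coalition $S$. The core of the TU game $\langle N,\eta\rangle$ is $$C(\eta)=\Big\{x\in\mathbb{R}^n : \sum_{i\in N}x_i=\eta_N,\ \sum_{i\in S}x_i\ge\eta_S\text{ for all nonempty }S\subsetneq N\Big\}.$$ The bounding set of player $i$ in the game at time $t$ is $$X_i(t)=\Big\{x\in\mathbb{R}^n : \sum_{j\in N}x_j=v_N(t),\ \sum_{j\in S}x_j\ge v_S(t)\text{ for all }S\subsetneq N\text{ with }i\in S\Big\}.$$ $P_X[w]$ denotes the Euclidean projection of $w$ on the closed convex set $X$; $\|\cdot\|$ is the Euclidean norm. At each time $t$ there is a directed graph $\mathcal{G}(t)=(N,\mathcal{E}(t))$ (the players' neighbor-graph), with $(i,i)\in\mathcal{E}(t)$ for all $i$; a link $(i,j)\in\mathcal{E}(t)$ means that player $j$ is a neighbor of player $i$ at time $t$, i.e., player $i$ can observe the allocation of player $j$ at time $t$. The scalar $a_{ij}(t)$ is the weight that player $i$ assigns to the allocation $x^j(t)$ proposed by player $j$; the weights satisfy $a_{ij}(t)\ge 0$ if $(i,j)\in\mathcal{E}(t)$ and $a_{ij}(t)=0$ if $(i,j)\notin\mathcal{E}(t)$. A square matrix is doubly stochastic if its entries are nonnegative and all its rows and columns sum to 1. The initial allocations $x^i(0)\in\mathbb{R}^n$, $i\in N$, are selected randomly and independently of $\{v(t)\}$.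
   Formalization: Each link (i,j) in E(t) is assumed to carry a positive weight a_ij(t) > 0, where the text only asks a_ij(t) ≥ 0; with zero weights allowed on links (e.g. A(t) = identity on complete graphs) the claim fails. *)

(* Defs.v *)
From HB Require Import structures.
From mathcomp Require Import all_boot all_order all_algebra.
From mathcomp Require Import all_classical all_reals all_analysis.

Set Implicit Arguments.
Unset Strict Implicit.
Unset Printing Implicit Defensive.

Import Order.TTheory GRing.Theory Num.Theory.
Import numFieldNormedType.Exports.

Local Open Scope classical_set_scope.
Local Open Scope ring_scope.

(* The players are the elements of 'I_n.+1, so that there is at least one. *)

Definition coalition (n : nat) : Type := {S : {set 'I_n.+1} | S != finset.set0}.

Lemma grand_neq0 (n : nat) : [set: 'I_n.+1]%SET != finset.set0.
Proof. by apply/set0Pn; exists ord0; rewrite finset.in_setT. Qed.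

Definition grand (n : nat) : coalition n :=
  exist (fun S : {set 'I_n.+1} => S != finset.set0) [set: 'I_n.+1]%SET
    (grand_neq0 n).

(* R^m with m = 2^(n+1) - 1, the coordinates being labelled by coalitions. *)
Definition charfun (R : Type) (n : nat) : Type := {ffun coalition n -> R}.

Definition core (R : realType) (n : nat) (eta : charfun R n) :
    set 'rV[R]_n.+1 :=
  [set x | \sum_(i < n.+1) x ord0 i = eta (grand n) /\
    forall S : coalition n, S != grand n ->
      eta S <= \sum_(i in val S) x ord0 i].

Definition bounding_set (R : realType) (n : nat) (eta : charfun R n)
    (i : 'I_n.+1) : set 'rV[R]_n.+1 :=
  [set x | \sum_(j < n.+1) x ord0 j = eta (grand n) /\
    forall S : coalition n, S != grand n -> i \in val S ->
      eta S <= \sum_(j in val S) x ord0 j].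

(* The library norm `|x| on row vectors is the sup norm, hence this one. *)
Definition enorm (R : realType) (n : nat) (x : 'rV[R]_n) : R :=
  Num.sqrt (\sum_(i < n) x ord0 i ^+ 2).

(* The point of X nearest to w, which exists and is unique when X is nonempty,
   closed and convex; the default value w is only taken when no such point
   exists. *)
Definition euclid_proj (R : realType) (n : nat) (X : set 'rV[R]_n) (w : 'rV[R]_n) :
    'rV[R]_n :=
  xget w [set p | X p /\ forall y, X y -> enorm (w - p) <= enorm (w - y)].

Definition doubly_stochastic (R : realType) (n : nat) (A : 'M[R]_n) : Prop :=
  [/\ forall i j, 0 <= A i j,
      forall i, \sum_(j < n) A i j = 1 &
      forall j, \sum_(i < n) A i j = 1].

Definition strongly_connected (V : finType) (e : rel V) : Prop :=
  forall i j : V, connect e i j.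

Definition union_graph (V : finType) (E : nat -> rel V) (a b : nat) : rel V :=
  [rel i j | has (fun tau => E tau i j) (index_iota a b)].

Section RandomFamilies.
Context {d : measure_display} {T : measurableType d} {R : realType}.

(* A random vector is given by its family of coordinates. *)
Definition random_family (I : Type) (Y : I -> T -> R) : Prop :=
  forall i, measurable_fun setT (Y i).

Definition sigma_of (I : Type) (Y : I -> T -> R) : set (set T) :=
  <<s \bigcup_i preimage_set_system setT (Y i) measurable >>.

(* Joint independence of two families; nothing is required of the members of
   one and the same family. *)
Definition independent_families (P : probability T R) (I J : Type)
    (Y : I -> T -> R) (Z : J -> T -> R) : Prop :=
  forall A B : set T, sigma_of Y A -> sigma_of Z B ->
    P (A `&` B) = (P A * P B)%E.

End RandomFamilies.

(* Main.v *)
Require Import Defs.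
From HB Require Import structures.
From mathcomp Require Import all_boot all_order all_algebra.
From mathcomp Require Import all_classical all_reals all_analysis.
From mathcomp Require Import measurable_realfun ring lra.

Set Implicit Arguments.
Unset Strict Implicit.
Unset Printing Implicit Defensive.

Import Order.TTheory GRing.Theory Num.Theory.
Import numFieldNormedType.Exports.

Local Open Scope classical_set_scope.
Local Open Scope ring_scope.

(* Fix an outcome for which v(t) = vmax infinitely often.  For z in the core of
   vmax, let V(t) be the sum over i of |x^i(t) - z|^2, and let w^i(t) be the
   weighted average that player i projects.  As z lies in every bounding set,
   Jensen's identity, the obtuse-angle property of projections and double
   stochasticity make V decrease by at least
     sum_i (|w^i - x^i(t+1)|^2 + sum_j a_ij(t) |x^j(t) - w^i|^2).
   V is bounded below, so this loss tends to 0: successive allocations of one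
   player, and allocations of players linked at time t, become close.  Chaining
   links over a window of length Q, whose union graph is strongly connected,
   gives consensus, without any estimate on products of weight matrices.  A
   cluster point l of x(t+1) along the times t with v(t) = vmax then lies in
   every bounding set of vmax, that is, in the core; V taken at z = l is
   nonincreasing and has 0 as a limit point, so it tends to 0. *)

(** * Euclidean projection onto closed convex sets, and the variance identity *)

Section EuclideanProjection.
Context {R : realType} {n : nat}.
Implicit Types (x y z w p : 'rV[R]_n) (X : set 'rV[R]_n).

(** Squaring preserves the order given by [enorm] and keeps the algebra polynomial. The topology
    comes from the sup norm, hence the two comparisons with it below. *)
Definition sqnorm x : R := \sum_(k < n) x ord0 k ^+ 2.

Lemma sqnorm_ge0 x : 0 <= sqnorm x.
Proof. by apply: sumr_ge0 => k _; exact: sqr_ge0. Qed.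

Lemma le_enorm x y : (enorm x <= enorm y) = (sqnorm x <= sqnorm y).
Proof. by rewrite ler_sqrt// sqnorm_ge0. Qed.

Lemma sqnormBC x y : sqnorm (x - y) = sqnorm (y - x).
Proof. by apply: eq_bigr => k _; rewrite !mxE -sqrrN opprB. Qed.

Lemma coord_le_norm x k : `|x ord0 k| <= `|x|.
Proof.
by rewrite [leRHS]/Num.norm /= mx_normrE; apply/bigmax_geP; right; exists (ord0, k).
Qed.

Lemma norm_sq_le_sqnorm x : `|x| ^+ 2 <= sqnorm x.
Proof.
rewrite -[leRHS]sqr_sqrtr ?sqnorm_ge0// ler_sqr ?nnegrE ?sqrtr_ge0//.
rewrite [leLHS]/Num.norm /= mx_normrE; apply/bigmax_leP; split=> [|[i k] _ /=].
  exact: sqrtr_ge0.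
rewrite -sqrtr_sqr ler_sqrt ?sqnorm_ge0// ord1 /sqnorm (bigD1 k)//= lerDl.
by apply: sumr_ge0 => j _; exact: sqr_ge0.
Qed.

Lemma sqnorm_le_norm_sq x : sqnorm x <= n%:R * `|x| ^+ 2.
Proof.
rewrite -[n in n%:R]card_ord -sum1_card natr_sum mulr_suml ler_sum// => k _.
by rewrite mul1r -real_normK ?num_real// ler_sqr ?nnegrE// coord_le_norm.
Qed.

Lemma continuous_sum_coord (S : pred 'I_n) :
  continuous (fun x : 'rV[R]_n => \sum_(k | S k) x ord0 k).
Proof.
apply: (@continuous_big _ _ +%R); last by move=> k _; exact: coord_continuous.
exact: add_continuous.
Qed.

Lemma continuous_sqnormB w : continuous (fun x : 'rV[R]_n => sqnorm (w - x)).
Proof.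
apply: (@continuous_big _ _ +%R) => [|k _]; first exact: add_continuous.
have wB : continuous (fun x : 'rV[R]_n => w ord0 k - x ord0 k).
  by move=> x; apply: continuousB; [exact: cst_continuous|exact: coord_continuous].
rewrite (_ : (fun _ => _) =
    (fun x : 'rV[R]_n => (w ord0 k - x ord0 k) * (w ord0 k - x ord0 k))).
  by move=> x; exact: (continuousM (wB x) (wB x)).
by apply/funext => x; rewrite !mxE expr2.
Qed.

Lemma euclid_projP X w : X !=set0 -> closed X ->
  X (euclid_proj X w) /\
  forall y, X y -> sqnorm (w - euclid_proj X w) <= sqnorm (w - y).
Proof.
move=> [y0 Xy0] clX.
(* Only points at least as close to [w] as [y0] compete, and they form a compact set. *)
pose K := X `&` [set y | sqnorm (w - y) <= sqnorm (w - y0)].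
have [p /set_mem[Xp _] pmin] : exists2 p, p \in K &
    forall y, y \in K -> sqnorm (w - p) <= sqnorm (w - y).
  apply: (@compact_EVT_min _ _ (fun y => sqnorm (w - y))).
  - by exists y0; split => /=.
  - apply: bounded_closed_compact; last first.
      apply: closedI => //.
      by apply: (closed_comp (D := [set r | r <= sqnorm (w - y0)])) => [y _|];
        [exact: continuous_sqnormB|exact: closed_le].
    (* The summand 1 is there because a real [u] is at most [u ^+ 2 + 1]. *)
    exists (`|w| + (sqnorm (w - y0) + 1)); split; first exact: num_real.
    move=> M ltM y [_ /= wy]; apply: le_trans (ltW ltM).
    rewrite -[y](subKr w); apply: le_trans (ler_normB _ _) _; rewrite lerD2l.
    have := norm_sq_le_sqnorm (w - y); have := sqr_ge0 (`|w - y| - 1); nra.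
  - by apply: continuous_subspaceT => y; exact: continuous_sqnormB.
suff : X (euclid_proj X w) /\
    forall y, X y -> enorm (w - euclid_proj X w) <= enorm (w - y).
  by move=> [? h]; split=> // y Xy; rewrite -le_enorm; exact: h.
(* The minimizer [p] rules out the default value of [xget]. *)
rewrite /euclid_proj; case: xgetP => [q _ //|/(_ p) []].
split=> // y Xy; rewrite le_enorm.
have [le_y0|/ltW lt_y0] := leP (sqnorm (w - y)) (sqnorm (w - y0)).
  by apply: pmin; apply: mem_set.
by apply: le_trans lt_y0; apply: pmin; apply: mem_set; split => /=.
Qed.

Definition segment_closed X :=
  forall y z (s : R), X y -> X z -> 0 <= s <= 1 -> X (y + s *: (z - y)).

(** Moving from [p] a fraction [s] of the way to [z] stays in [X] and cannot come closer to [w]. For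
    small [s] this forces the inner product [c] of [w - p] and [z - p] to be nonpositive; the
    expansion at [s = 1] then gives the claim. *)
Lemma nearest_pythagoras X w p z : segment_closed X -> X p ->
  (forall y, X y -> sqnorm (w - p) <= sqnorm (w - y)) -> X z ->
  sqnorm (p - z) + sqnorm (w - p) <= sqnorm (w - z).
Proof.
move=> cvX Xp pmin Xz.
pose c := \sum_(k < n) (w ord0 k - p ord0 k) * (z ord0 k - p ord0 k).
have expand (s : R) :
    sqnorm (w - (p + s *: (z - p))) =
    sqnorm (w - p) - s *+ 2 * c + s ^+ 2 * sqnorm (p - z).
  rewrite !mulr_sumr -sumrB -big_split; apply: eq_bigr => k _.
  by rewrite /= !mxE; ring.
have c_small (s : R) : 0 < s -> s <= 1 -> c *+ 2 <= s * sqnorm (p - z).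
  move=> s0 s1; have := pmin _ (cvX p z s Xp Xz _).
  rewrite expand (ltW s0) s1 => /(_ isT) h.
  by rewrite -(ler_pM2l s0); nra.
suff c0 : c <= 0.
  by have := expand 1; rewrite scale1r subrKC expr1n !mul1r => ->; lra.
rewrite leNgt; apply/negP => c0.
have := sqnorm_ge0 (p - z); set D := sqnorm _ in c_small * => D0.
(* With this [s], the product [s * D] is at most [c], hence below [c *+ 2]. The denominator stays
   positive even when [D = 0]. *)
have s0 : 0 < c / (D + c) by rewrite divr_gt0//; lra.
have s1 : c / (D + c) <= 1 by rewrite ler_pdivrMr; lra.
have := c_small _ s0 s1; rewrite mulrAC ler_pdivlMr; nra.
Qed.

Lemma sqnorm_jensen (I : finType) (a : I -> R) (y : I -> 'rV[R]_n) z :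
  \sum_i a i = 1 ->
  \sum_i a i * sqnorm (y i - z) =
  sqnorm (\sum_i a i *: y i - z) +
  \sum_i a i * sqnorm (y i - \sum_j a j *: y j).
Proof.
move=> a1; set w := \sum_i a i *: y i.
transitivity (\sum_(k < n) \sum_i a i * (y i ord0 k - z ord0 k) ^+ 2).
  rewrite exchange_big; apply: eq_bigr => i _; rewrite mulr_sumr.
  by apply: eq_bigr => k _; rewrite !mxE.
transitivity (\sum_(k < n) ((w ord0 k - z ord0 k) ^+ 2 +
    \sum_i a i * (y i ord0 k - w ord0 k) ^+ 2)); last first.
  rewrite big_split/=; congr (_ + _); first by apply: eq_bigr => k _; rewrite !mxE.
  rewrite exchange_big; apply: eq_bigr => i _; rewrite mulr_sumr.
  by apply: eq_bigr => k _; rewrite !mxE.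
apply: eq_bigr => k _.
have wk : w ord0 k = \sum_i a i * y i ord0 k.
  by rewrite summxE; apply: eq_bigr => i _; rewrite mxE.
(* The difference of the two squares is affine in [y i], so its weighted sum is determined by the
   total weight 1 and the mean [w]. *)
have -> : \sum_i a i * (y i ord0 k - z ord0 k) ^+ 2 =
    \sum_i (a i * (y i ord0 k - w ord0 k) ^+ 2 +
      ((w ord0 k - z ord0 k) *+ 2 * (a i * y i ord0 k) +
      (z ord0 k ^+ 2 - w ord0 k ^+ 2) * a i)).
  by apply: eq_bigr => i _; ring.
by rewrite !big_split/= -!mulr_sumr a1 -wk; ring.
Qed.

End EuclideanProjection.

(** * Bounding sets: closedness, convexity, relation to the core *)

Section BoundingSets.
Context {R : realType} {n : nat}.
Implicit Types (eta : charfun R n) (i : 'I_n.+1).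

Lemma closed_bounding_set eta i : closed (bounding_set eta i).
Proof.
rewrite (_ : bounding_set eta i =
    [set y : 'rV[R]_n.+1 | \sum_(j < n.+1) y ord0 j = eta (grand n)] `&`
    \bigcap_(S in [set S : coalition n | S != grand n /\ i \in val S])
      [set y : 'rV[R]_n.+1 | eta S <= \sum_(j in val S) y ord0 j]).
  apply: closedI.
    apply: (closed_comp (D := [set r | r = eta (grand n)])) => [y _|].
      exact: continuous_sum_coord.
    exact: closed_eq.
  apply: closed_bigI => S _.
  apply: (closed_comp (D := [set r | eta S <= r])) => [y _|].
    exact: continuous_sum_coord.
  exact: closed_ge.
by apply/seteqP; split=> y [yN yS]; split=> // S; [move=> [? ?]|move=> ? ?]; apply: yS.
Qed.

Lemma segment_closed_bounding_set eta i : segment_closed (bounding_set eta i).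
Proof.
move=> y z s [yN yS] [zN zS] /andP[s0 s1].
have sumE (S : pred 'I_n.+1) :
    \sum_(j | S j) (y + s *: (z - y)) ord0 j =
    (1 - s) * (\sum_(j | S j) y ord0 j) + s * (\sum_(j | S j) z ord0 j).
  rewrite !mulr_sumr -big_split; apply: eq_bigr => j _.
  by rewrite /= !mxE; ring.
split=> [|S SN iS]; first by rewrite sumE yN zN; ring.
by rewrite sumE; have := yS _ SN iS; have := zS _ SN iS; nra.
Qed.

(** A coalition is nonempty, so its constraint appears in the bounding set of any of its members. *)
Lemma core_eq_bigcap eta : core eta = \bigcap_i bounding_set eta i.
Proof.
apply/seteqP; split=> [y [yN yS] i _|y yX]; first by split=> // S SN _; exact: yS.
split=> [|S SN]; first by have [] := yX ord0 I.
by have /set0Pn[i iS] := valP S; have [_ /(_ S SN iS)] := yX i I.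
Qed.

Lemma core_sub_bounding_set (eta eta' : charfun R n) i :
  eta (grand n) = eta' (grand n) ->
  (forall S, S != grand n -> eta S <= eta' S) ->
  core eta' `<=` bounding_set eta i.
Proof.
move=> etaN etaS y [yN yS]; split=> [|S SN _]; first by rewrite etaN.
exact: le_trans (etaS _ SN) (yS _ SN).
Qed.

End BoundingSets.

(** * Distances accumulated along paths of a graph *)

Lemma path_dist_le {R : realType} {V : normedZmodType R} {I : eqType} (e : rel I)
    (f : I -> V) (c : R) i p :
  (forall j k, e j k -> `|f j - f k| <= c) -> path e i p ->
  `|f i - f (last i p)| <= c *+ size p.
Proof.
move=> efc; elim: p i => [|j p IHp] i /=; first by rewrite subrr normr0.
move=> /andP[ij /IHp jp]; rewrite mulrS.
by apply: le_trans (ler_distD (f j) _ _) _; rewrite lerD// efc.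
Qed.

(** A path can be shortened until it repeats no vertex, which bounds its length by the number of
    vertices. *)
Lemma connect_dist_le {R : realType} {V : normedZmodType R} {I : finType}
    (e : rel I) (f : I -> V) (c : R) i j :
  0 <= c -> (forall j k, e j k -> `|f j - f k| <= c) -> connect e i j ->
  `|f i - f j| <= c *+ #|I|.
Proof.
move=> c0 efc /connectP[p ip ->]; have [q iq uq _] := shortenP ip.
apply: le_trans (path_dist_le efc iq) _.
rewrite ler_wpMn2l// (leq_trans (leqnSn _))//.
by have /card_uniqP /= <- := uq; exact: max_card.
Qed.

(** * Convergence of the protocol for one fixed outcome *)

Section Bargaining.
Context {R : realType} {n : nat}.
Variables (v : nat -> charfun R n) (vmax : charfun R n).
Variables (E : nat -> rel 'I_n.+1) (A : nat -> 'M[R]_n.+1) (alpha : R) (Q : nat).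
Variable x : nat -> 'I_n.+1 -> 'rV[R]_n.+1.
Hypothesis v_grand : forall t, v t (grand n) = vmax (grand n).
Hypothesis v_le : forall t S, S != grand n -> v t S <= vmax S.
Hypothesis core_nonempty : core vmax !=set0.
Hypothesis A_stoch : forall t, doubly_stochastic (A t).
Hypothesis alpha_gt0 : 0 < alpha.
Hypothesis A_ge : forall t i j, E t i j -> alpha <= A t i j.
Hypothesis E_refl : forall t i, E t i i.
Hypothesis Q_gt0 : (0 < Q)%N.
Hypothesis connected :
  forall t, strongly_connected (union_graph E (t * Q) (t.+1 * Q)).

Let avg t i := \sum_(j < n.+1) A t i j *: x t j.

Hypothesis protocol :
  forall t i, x t.+1 i = euclid_proj (bounding_set (v t) i) (avg t i).

Let lyapunov z t := \sum_i sqnorm (x t i - z).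

Let loss t i :=
  sqnorm (avg t i - x t.+1 i) + \sum_j A t i j * sqnorm (x t j - avg t i).

Let core_bounding_set z t i : core vmax z -> bounding_set (v t) i z.
Proof. by apply: core_sub_bounding_set; [exact: v_grand|exact: v_le]. Qed.

Lemma protocolP t i :
  bounding_set (v t) i (x t.+1 i) /\
  forall y, bounding_set (v t) i y ->
    sqnorm (avg t i - x t.+1 i) <= sqnorm (avg t i - y).
Proof.
rewrite protocol; apply: euclid_projP; last exact: closed_bounding_set.
by have [z coz] := core_nonempty; exists z; exact: core_bounding_set.
Qed.

Lemma lyapunov_decrease z t :
  core vmax z -> lyapunov z t.+1 + \sum_i loss t i <= lyapunov z t.
Proof.
move=> coz; have [_ A_row A_col] := A_stoch t.
(* Unit column sums spread each player's term over the averages; unit row sums then allow Jensen's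
   identity for each [i]. *)
have -> : lyapunov z t = \sum_i \sum_j A t i j * sqnorm (x t j - z).
  rewrite exchange_big; apply: eq_bigr => j _.
  by rewrite -mulr_suml A_col mul1r.
rewrite -big_split; apply: ler_sum => i _ /=.
rewrite sqnorm_jensen// /loss addrA lerD2r.
have [xX xmin] := protocolP t i.
apply: (nearest_pythagoras _ xX xmin); last exact: core_bounding_set.
exact: segment_closed_bounding_set.
Qed.

Let A_ge0 t i j : 0 <= A t i j.
Proof. by have [] := A_stoch t. Qed.

Lemma loss_ge0 t i : 0 <= loss t i.
Proof.
rewrite addr_ge0 ?sqnorm_ge0// sumr_ge0// => j _.
by rewrite mulr_ge0// sqnorm_ge0.
Qed.

Lemma lyapunov_nonincreasing z : core vmax z -> nonincreasing_seq (lyapunov z).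
Proof.
move=> coz; apply/nonincreasing_seqP => t.
apply: le_trans (lyapunov_decrease t coz); rewrite lerDl sumr_ge0// => i _.
exact: loss_ge0.
Qed.

Lemma lyapunov_ge0 z t : 0 <= lyapunov z t.
Proof. by apply: sumr_ge0 => i _; exact: sqnorm_ge0. Qed.

Lemma sq_dist_le_lyapunov z t i : `|x t i - z| ^+ 2 <= lyapunov z t.
Proof.
apply: le_trans (norm_sq_le_sqnorm _) _; rewrite /lyapunov (bigD1 i)//= lerDl.
by apply: sumr_ge0 => j _; exact: sqnorm_ge0.
Qed.

Lemma loss_cvg0 : \sum_i loss t i @[t --> \oo] --> (0 : R).
Proof.
have [z coz] := core_nonempty.
have cvgV : cvgn (lyapunov z).
  apply: nonincreasing_is_cvgn; first exact: lyapunov_nonincreasing.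
  by exists 0 => _ [t _ <-]; exact: lyapunov_ge0.
have : lyapunov z t - lyapunov z t.+1 @[t --> \oo] --> (0 : R).
  rewrite -(subrr (limn (lyapunov z))); apply: cvgB => //.
  by rewrite (cvg_shiftS (lyapunov z)).
apply: (@squeeze_cvgr _ _ _ _ (cst 0)); last exact: cvg_cst.
apply: nearW => t; rewrite sumr_ge0/=; last by move=> i _; exact: loss_ge0.
by rewrite lerBrDl; exact: lyapunov_decrease.
Qed.

Lemma near_avg e : 0 < e -> \forall t \near \oo, forall i j, E t i j ->
  `|avg t i - x t.+1 i| <= e /\ `|x t j - avg t i| <= e.
Proof.
move=> e0.
(* The factor 1 serves the projection displacement, which enters the loss unweighted; [alpha] serves
   the disagreement, weighted by some [A t i j >= alpha]. *)
have c0 : 0 < Num.min 1 alpha * e ^+ 2.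
  by rewrite mulr_gt0 ?exprn_gt0// lt_min ltr01.
have /cvgrPdist_lt /(_ _ c0) := loss_cvg0.
apply: filterS => t; rewrite sub0r normrN ger0_norm; last first.
  by apply: sumr_ge0 => i _; exact: loss_ge0.
move=> loss_lt i j ij.
have {loss_lt} : loss t i < Num.min 1 alpha * e ^+ 2.
  apply: le_lt_trans loss_lt; rewrite (bigD1 i)//= lerDl.
  by apply: sumr_ge0 => k _; exact: loss_ge0.
rewrite -ltr_pdivrMr ?exprn_gt0// lt_min !ltr_pdivrMr ?exprn_gt0// mul1r.
have sum_ge0 : 0 <= \sum_(k | k != j) A t i k * sqnorm (x t k - avg t i).
  by apply: sumr_ge0 => k _; rewrite mulr_ge0// sqnorm_ge0.
rewrite /loss (bigD1 j)//= => /andP[lt1 lt2].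
have Aij := A_ge ij.
have s1 := sqnorm_ge0 (avg t i - x t.+1 i); have s2 := sqnorm_ge0 (x t j - avg t i).
split; rewrite -ler_sqr ?nnegrE ?(ltW e0)//;
    apply: le_trans (norm_sq_le_sqnorm _) _.
- apply: le_trans (ltW lt1); rewrite lerDl addr_ge0// mulr_ge0//.
- rewrite -(ler_pM2l alpha_gt0); apply: le_trans (ltW lt2).
  by have := ler_wpM2r s2 Aij; lra.
Qed.

Lemma consensus e : 0 < e ->
  \forall t \near \oo, forall i j, `|x t i - x t j| <= e.
Proof.
(* In units of [d = e / C]: at most [n.+1] links at [4 * Q + 2] each, plus [4 * Q] for the drift of
   two players from the window start to [t]. The total is at most [(8 * Q + 2) * n.+1]. *)
move=> e0; set C : R := (8 * Q + 2)%:R * n.+1%:R.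
have C0 : 0 < C by rewrite mulr_gt0// ltr0n// addn2.
have [N _ small] := near_avg (divr_gt0 e0 C0); set d := e / C in small.
have d0 : 0 <= d by rewrite ltW// divr_gt0.
(* The self-loop at [i] puts [x t i] itself within [d] of [avg t i], as the link does for
   [x t j]. *)
have link t i j : (N <= t)%N -> E t i j -> `|x t i - x t j| <= d *+ 2.
  move=> Nt ij; have [_ dj] := small _ Nt _ _ ij.
  have [_ di] := small _ Nt _ _ (E_refl t i).
  rewrite mulr2n; apply: le_trans (ler_distD (avg t i) _ _) _.
  by rewrite lerD// distrC.
have drift t k i : (N <= t)%N -> `|x (t + k)%N i - x t i| <= d *+ (2 * k).
  move=> Nt; elim: k => [|k IHk]; first by rewrite addn0 subrr normr0.
  rewrite addnS mulnS mulrnDr; apply: le_trans (ler_distD (x (t + k)%N i) _ _) _.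
  rewrite lerD// mulr2n.
  have [] := small (t + k)%N (leq_trans Nt (leq_addr _ _)) _ _ (E_refl _ i).
  move=> d1 d2; apply: le_trans (ler_distD (avg (t + k)%N i) _ _) _.
  by rewrite lerD// distrC.
have driftQ t k i : (N <= t)%N -> (k < Q)%N ->
    `|x (t + k)%N i - x t i| <= d *+ (2 * Q).
  move=> Nt kQ; apply: le_trans (drift _ _ _ Nt) _.
  by rewrite ler_wpMn2l// leq_mul2l ltnW.
(* A link active at time [b * Q + k] is carried back to the window start [b * Q] at the cost of one
   drift for each endpoint. *)
have block b i j : (N <= b * Q)%N ->
    `|x (b * Q)%N i - x (b * Q)%N j| <= d *+ (4 * Q + 2) *+ n.+1.
  move=> NbQ; rewrite -[n.+1 in leRHS]card_ord.
  apply: (connect_dist_le _ _ (connected b i j)); first by rewrite mulrn_wge0.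
  move=> {}i {}j /hasP[tau]; rewrite mem_index_iota mulSn => /andP[btau].
  rewrite -(subnKC btau) addnC ltn_add2r => kQ.
  set k := (tau - _)%N in kQ *; rewrite addnC => ij.
  have Ntau : (N <= b * Q + k)%N by apply: leq_trans (leq_addr _ _).
  have := link _ _ _ Ntau ij; have := driftQ _ _ i NbQ kQ.
  have := driftQ _ _ j NbQ kQ.
  rewrite mulrnDr (_ : 4 * Q = 2 * Q + 2 * Q)%N ?mulrnDr; last by rewrite -mulnDl.
  move=> dj di dij.
  apply: le_trans (ler_distD (x (b * Q + k)%N i) _ _) _.
  rewrite -addrA lerD//; first by rewrite distrC.
  apply: le_trans (ler_distD (x (b * Q + k)%N j) _ _) _.
  by rewrite addrC lerD.
(* The margin [Q] makes the window containing [t] start no earlier than [N]. *)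
exists (N + Q)%N => // t /= NQt i j.
have NbQ : (N <= t %/ Q * Q)%N.
  rewrite -(leq_add2r Q); apply: leq_trans NQt _.
  by rewrite addnC -mulSn ltnW// ltn_ceil.
have dE : e = d *+ (8 * Q + 2) *+ n.+1.
  by rewrite -mulr_natr -[d *+ _]mulr_natr -mulrA divfK// gt_eqF.
have kQ : (t %% Q < Q)%N by rewrite ltn_mod.
rewrite (divn_eq t Q).
have := driftQ _ _ i NbQ kQ; have := driftQ _ _ j NbQ kQ; have := block _ i j NbQ.
set b := (t %/ Q)%N; set k := (t %% Q)%N => dij dj di.
apply: le_trans (ler_distD (x (b * Q)%N i) _ _) _.
apply: (@le_trans _ _ (d *+ (2 * Q) + (d *+ (4 * Q + 2) *+ n.+1 + d *+ (2 * Q)))).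
  rewrite lerD//; apply: le_trans (ler_distD (x (b * Q)%N j) _ _) _.
  by rewrite lerD// distrC.
rewrite dE addrC -addrA -mulrnDr.
rewrite (_ : 8 * Q + 2 = (4 * Q + 2) + (2 * Q + 2 * Q))%N; last first.
  by rewrite addnAC -mulnDl -mulnDl.
rewrite [in leRHS]mulrnDr mulrnDl lerD2l -mulrnA ler_wpMn2l//.
by rewrite addnn -muln2 leq_pmulr.
Qed.

Lemma bargaining_cvg :
  (forall k, exists t, (k <= t)%N /\ v t = vmax) ->
  exists2 l, core vmax l & forall i, x t i @[t --> \oo] --> l.
Proof.
move=> /choice[s sP]; have [z coz] := core_nonempty.
pose K : set 'rV[R]_n.+1 := [set y | `|y| <= `|z| + (lyapunov z 0 + 1)].
have K_compact : compact K.
  apply: bounded_closed_compact; last first.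
    apply: (closed_comp (D := [set r | r <= `|z| + (lyapunov z 0 + 1)])).
      by move=> y _; exact: norm_continuous.
    exact: closed_le.
  exists (`|z| + (lyapunov z 0 + 1)); split; first exact: num_real.
  by move=> M ltM y yK; exact: le_trans yK (ltW ltM).
have xK t i : K (x t i).
  rewrite /K/= -[x t i](subrK z) addrC.
  apply: le_trans (ler_normD _ _) _; rewrite lerD2l.
  have := sq_dist_le_lyapunov z t i.
  have := lyapunov_nonincreasing coz (leq0n t).
  have := sqr_ge0 (`|x t i - z| - 1); nra.
(* The successor matters: it is [x t.+1 i] that lies in the bounding set of time [t]. Following one
   player suffices, since consensus brings in the others. *)
pose y k := x (s k).+1 ord0.
have [|l [_ cl_l]] := K_compact (y @ \oo) _; first by exists 0%N => // k _; exact: xK.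
have freq e k : 0 < e -> exists2 t, (k <= t)%N & v t = vmax /\ `|l - x t.+1 ord0| < e.
  move=> e0; have : nbhs l (ball l e) by exact: nbhsx_ballx.
  have : (y @ \oo) [set y j | j in [set j | (k <= j)%N]].
    by exists k => // j /= kj; exists j.
  move=> yF /(cl_l _ _ yF)[_ [[j /= kj <-]]].
  rewrite -ball_normE /= => lj.
  by have [js vs] := sP j; exists (s j) => //; exact: leq_trans js.
have close e k : 0 < e ->
    exists2 t, (k <= t)%N & v t = vmax /\ forall i, `|l - x t.+1 i| < e.
  move=> e0; have e20 : 0 < e / 2 by rewrite divr_gt0.
  have [N _ cons] := consensus e20.
  have [t kNt [vt lt]] := freq _ (maxn k N) e20.
  move: kNt; rewrite geq_max => /andP[kt Nt]; exists t => //; split=> // i.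
  apply: le_lt_trans (ler_distD (x t.+1 ord0) _ _) _.
  rewrite [e]splitr ltr_leD//; apply: cons => /=; exact: leq_trans Nt _.
have col : core vmax l.
  rewrite core_eq_bigcap => i _; apply: closed_bounding_set => B.
  rewrite nbhs_ballP => -[e /= e0 leB].
  have [t _ [vt lt]] := close _ 0%N e0; exists (x t.+1 i); split.
    by have [+ _] := protocolP t i; rewrite vt.
  by apply: leB; rewrite -ball_normE /=; exact: lt.
exists l => // i; apply/cvgrPdist_le => e e0.
(* One factor [n.+1] pays for the sum over players, another for passing from the sup norm to
   [sqnorm]; together they cancel the squared denominator. *)
have d0 : 0 < e / n.+1%:R by rewrite divr_gt0.
have [t _ [_ lt]] := close _ 0%N d0.
have Vt : lyapunov l t.+1 <= e ^+ 2.
  apply: (@le_trans _ _ (\sum_(j < n.+1) n.+1%:R * (e / n.+1%:R) ^+ 2)).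
    apply: ler_sum => j _; apply: le_trans (sqnorm_le_norm_sq _) _.
    rewrite ler_pM2l ?ltr0n// ler_sqr ?nnegrE ?(ltW d0)//.
    by rewrite distrC ltW.
  rewrite sumr_const card_ord -[leLHS]mulr_natl mulrA -expr2 -exprMn.
  by rewrite mulrC divfK.
exists t.+1 => // u /= tu; rewrite distrC -ler_sqr ?nnegrE ?(ltW e0)//.
apply: le_trans (sq_dist_le_lyapunov _ _ _) _.
by apply: le_trans Vt; exact: lyapunov_nonincreasing.
Qed.

End Bargaining.

(** * Measurability of the projection onto a random closed convex set *)

Section MeasurableProjection.
Context {d : measure_display} {T : measurableType d} {R : realType} {n : nat}.

Definition random_vector (f : T -> 'rV[R]_n) : Prop :=
  random_family (fun k w => f w ord0 k).

Lemma random_vector_cst y : random_vector (fun=> y).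
Proof. by move=> k; exact: measurable_cst. Qed.

Lemma random_vector_if (b : T -> bool) (f g : T -> 'rV[R]_n) :
  measurable_fun setT b -> random_vector f -> random_vector g ->
  random_vector (fun w => if b w then f w else g w).
Proof.
move=> mb mf mg k.
rewrite (_ : (fun _ => _) = fun w => if b w then f w ord0 k else g w ord0 k).
  exact: measurable_fun_ifT.
by apply/funext => w; case: ifP.
Qed.

Lemma measurable_sqnormB (f g : T -> 'rV[R]_n) :
  random_vector f -> random_vector g ->
  measurable_fun setT (fun w => sqnorm (f w - g w)).
Proof.
move=> mf mg; apply: measurable_sum => k.
rewrite (_ : (fun _ => _) = fun w => (f w ord0 k - g w ord0 k) ^+ 2).
  by apply: measurable_funX; apply: measurable_funB; [exact: mf|exact: mg].
by apply/funext => w; rewrite !mxE.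
Qed.

Lemma random_vector_cvg (h : nat -> T -> 'rV[R]_n) (f : T -> 'rV[R]_n) :
  (forall m, random_vector (h m)) -> (forall w, h ^~ w @ \oo --> f w) ->
  random_vector f.
Proof.
move=> mh hf k; apply: (measurable_fun_cvg (fun m => mh m k)) => w _.
exact: (cvg_comp (h ^~ w) (fun y : 'rV[R]_n => y ord0 k) (hf w)
  (@coord_continuous R 1 n ord0 k (f w))).
Qed.

(* The projection is the limit of the best approximations among the first m
   points of a fixed countable set whose trace on X w is dense in X w. *)
Lemma random_vector_euclid_proj (X : T -> set 'rV[R]_n) (f : T -> 'rV[R]_n)
    (c : 'rV[R]_n) (q : nat -> 'rV[R]_n) :
  (forall w, closed (X w)) -> (forall w, segment_closed (X w)) ->
  (forall w, X w c) -> (forall m, measurable [set w | X w (q m)]) ->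
  (forall w y e, X w y -> 0 < e -> exists m, X w (q m) /\ `|y - q m| <= e) ->
  random_vector f -> random_vector (fun w => euclid_proj (X w) (f w)).
Proof.
move=> clX cvX Xc mX denseX mf.
pose better m w y := `[< X w (q m) >] && (sqnorm (f w - q m) < sqnorm (f w - y)).
(* Greedy search from [c]: a new point is kept only if it lies in [X w] and is strictly closer to
   [f w]. Each stage is thus a measurable case distinction. *)
pose h : nat -> T -> 'rV[R]_n := fix h m w :=
  if m is k.+1 then if better k w (h k w) then q k else h k w else c.
have Xh m w : X w (h m w).
  by elim: m => [|m IHm] //=; case: ifP => // /andP[/asboolP].
have h_decr w : nonincreasing_seq (fun m => sqnorm (f w - h m w)).
  by apply/nonincreasing_seqP => m /=; case: ifP => // /andP[_ /ltW].
have h_best m w : X w (q m) -> sqnorm (f w - h m.+1 w) <= sqnorm (f w - q m).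
  by rewrite /= /better => /asboolP -> /=; case: ltP.
apply: (random_vector_cvg (h := h)).
  elim=> [|m IHm]; first exact: random_vector_cst.
  apply: (random_vector_if (b := fun w => better m w (h m w)) _
    (random_vector_cst (q m)) IHm).
  apply: measurable_and; last by apply: measurable_fun_ltr; exact: measurable_sqnormB.
  apply: (measurable_fun_bool true); rewrite setTI.
  rewrite (_ : _ @^-1` _ = [set w | X w (q m)])//.
  by apply/seteqP; split=> w /=; [move/asboolP|move=> ?; apply/asboolP].
move=> w; have [Xp pmin] := euclid_projP (f w) (ex_intro _ c (Xc w)) (clX w).
set p := euclid_proj _ _ in Xp pmin *.
apply/cvgrPdist_le => e e0.
have : nbhs p [set y | sqnorm (f w - y) < sqnorm (f w - p) + e ^+ 2].
  have lt_p : sqnorm (f w - p) < sqnorm (f w - p) + e ^+ 2.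
    by rewrite ltrDl exprn_gt0.
  exact: (@continuous_sqnormB _ _ (f w) p _ (lt_nbhsl lt_p)).
rewrite nbhs_ballP => -[r /= r0 rp].
have r20 : 0 < r / 2 by rewrite divr_gt0.
have [m [Xqm pq]] := denseX w p _ Xp r20.
have {rp} qm : sqnorm (f w - q m) < sqnorm (f w - p) + e ^+ 2.
  apply: rp; rewrite -ball_normE /=; apply: le_lt_trans pq _.
  by rewrite ltr_pdivrMr// ltr_pMr// ltr1n.
exists m.+1 => // k /= mk; rewrite -ler_sqr ?nnegrE ?(ltW e0)//.
apply: le_trans (norm_sq_le_sqnorm _) _.
(* The obtuse angle at [p] turns near-optimality into nearness: the squared distance from [p] to
   [h k w] is at most the excess over the minimum, which is below [e ^+ 2] once [q m] has been
   examined. *)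
have := nearest_pythagoras (cvX w) Xp pmin (Xh k w).
have := h_decr w _ _ mk; have := h_best _ _ Xqm; lra.
Qed.

End MeasurableProjection.

(** * A countable set dense in every bounding set of prescribed total *)

Section CountableGrid.
Context {R : realType} {n : nat} (s : R) (i : 'I_n.+1).

(** Rational points could all miss the hyperplane of total [s], so coordinate [i] is solved for and
    the total is exact. *)
Definition grid_point (z : {ffun 'I_n.+1 -> rat}) : 'rV[R]_n.+1 :=
  \row_k if k == i then s - \sum_(j | j != i) ratr (z j) else ratr (z k).

Lemma sum_grid_point z : \sum_k grid_point z ord0 k = s.
Proof.
rewrite (bigD1 i)//= mxE eqxx; set r := \sum_(j | j != i) _.
suff -> : \sum_(k | k != i) grid_point z ord0 k = r by rewrite subrK.
by apply: eq_bigr => k /negPf ki; rewrite mxE ki.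
Qed.

(* Rounding down every coordinate but the i-th preserves the constraints: at a
   fixed total, the share of a coalition containing i only grows when the shares
   of the players outside it decrease. *)
Lemma grid_point_dense (eta : charfun R n) y e :
  eta (grand n) = s -> bounding_set eta i y -> 0 < e ->
  exists z, bounding_set eta i (grid_point z) /\ `|y - grid_point z| <= e.
Proof.
move=> etaN [yN yS] e0; pose r := e / n.+1%:R.
have r0 : 0 < r by rewrite divr_gt0.
have round k : exists a : rat, y ord0 k - r < ratr a < y ord0 k.
  have : y ord0 k - r < y ord0 k by rewrite gtrBl.
  by move=> /rat_in_itvoo[a]; rewrite in_itv /=; exists a.
have [z0 z0P] := choice round.
pose z := [ffun k => z0 k]; exists z.
have zP k : k != i ->
    y ord0 k - r <= grid_point z ord0 k <= y ord0 k.
  move=> /negPf ki; rewrite mxE ki ffunE.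
  by have /andP[/ltW -> /ltW ->] := z0P k.
split.
  split=> [|S SN iS]; first by rewrite sum_grid_point.
  apply: le_trans (yS S SN iS) _.
  have := sum_grid_point z; rewrite -{1}etaN -yN.
  rewrite (bigID (mem (val S)))/= [RHS](bigID (mem (val S)))/= => sumE.
  have : \sum_(j | j \notin val S) grid_point z ord0 j <=
         \sum_(j | j \notin val S) y ord0 j.
    apply: ler_sum => j jS; have ji : j != i by apply: contraNneq jS => ->.
    by have /andP[] := zP j ji.
  by move: sumE; lra.
have re : r <= e by rewrite ler_pdivrMr// ler_peMr ?(ltW e0)// ler1n.
suff key k : `|y ord0 k - grid_point z ord0 k| <= e.
  rewrite [leLHS]/Num.norm /= mx_normrE; apply/bigmax_leP.
  by split=> [|[a k] _ /=]; [exact: ltW|rewrite ord1; have := key k; rewrite !mxE].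
have [->|ki] := eqVneq k i; last first.
  have /andP[lo hi] := zP k ki.
  by rewrite ger0_norm ?subr_ge0// (le_trans _ re)// lerBlDl -lerBlDr.
(* Coordinate [i] absorbs all the other rounding errors, which is why each was kept below
   [e / n.+1%:R]. *)
pose t := \sum_(j | j != i) (y ord0 j - grid_point z ord0 j).
have t0 : 0 <= t.
  by apply: sumr_ge0 => j /zP/andP[_ ?]; rewrite subr_ge0.
have te : t <= e.
  have -> : e = \sum_(j < n.+1) r.
    by rewrite sumr_const card_ord -[RHS]mulr_natr divfK.
  rewrite [leRHS](bigID (fun j => j != i))/=.
  apply: (@le_trans _ _ (\sum_(j | j != i) r)).
    by apply: ler_sum => j /zP/andP[? _]; rewrite lerBlDl -lerBlDr.
  by rewrite lerDl sumr_ge0// => j _; exact: ltW.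
have : y ord0 i - grid_point z ord0 i = - t.
  have := sum_grid_point z; rewrite -etaN -yN (bigD1 i)//= [RHS](bigD1 i)//=.
  by rewrite /t sumrB; lra.
by move=> ->; rewrite normrN ger0_norm.
Qed.

End CountableGrid.

(** * Measurability of the projections onto the random bounding sets *)

Section RandomBargaining.
Context {d : measure_display} {T : measurableType d} {R : realType} {n : nat}.

Lemma measurable_bounding_set (v : T -> charfun R n) i y :
  random_family (fun S w => v w S) ->
  measurable [set w | bounding_set (v w) i y].
Proof.
move=> mv.
have m_le (S : coalition n) r : measurable [set w | v w S <= r].
  rewrite -[X in measurable X]setTI.
  have := measurable_fun_ler (mv S) (measurable_cst r) measurableT.
  by move=> /(_ [set true] I); congr (measurable (_ `&` _)).
rewrite (_ : [set w | _] =
    [set w | \sum_(j < n.+1) y ord0 j = v w (grand n)] `&`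
    \bigcap_(S in [set S : coalition n | S != grand n /\ i \in val S])
      [set w | v w S <= \sum_(j in val S) y ord0 j]); last first.
  by apply/seteqP; split=> w [yN yS]; split=> // S; [move=> [? ?]|move=> ? ?];
    apply: yS.
apply: measurableI; last first.
  by apply: fin_bigcap_measurable; [exact: finite_finset|move=> S _; exact: m_le].
rewrite (_ : [set w | _] = v ^~ (grand n) @^-1` [set \sum_(j < n.+1) y ord0 j]).
  by rewrite -[X in measurable X]setTI; exact: mv.
by apply/seteqP; split=> w /=.
Qed.

Lemma random_vector_bounding_proj (v : T -> charfun R n) (s : R) i
    (f : T -> 'rV[R]_n.+1) (c : 'rV[R]_n.+1) :
  random_family (fun S w => v w S) -> (forall w, v w (grand n) = s) ->
  (forall w, bounding_set (v w) i c) -> random_vector f ->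
  random_vector (fun w => euclid_proj (bounding_set (v w) i) (f w)).
Proof.
move=> mv vN Xc mf.
(* Indices that code no grid point are sent to [c], which lies in every bounding set at hand. *)
pose q m := oapp (grid_point s i) c (unpickle m).
apply: (random_vector_euclid_proj (c := c) (q := q)) => //.
- by move=> w; exact: closed_bounding_set.
- by move=> w; exact: segment_closed_bounding_set.
- by move=> m; exact: measurable_bounding_set.
- move=> w y e Xy e0; have [z [Xz yz]] := grid_point_dense (vN w) Xy e0.
  by exists (pickle z); rewrite /q pickleK.
Qed.

End RandomBargaining.

(** * Almost sure convergence to a random core allocation *)

Theorem theorem1 (R : realType) (d : measure_display) (T : measurableType d)
  (P : probability T R) (n : nat)
  (* the dynamic TU game *)
  (v : nat -> T -> charfun R n)
  (v_random : forall t, random_family (fun (S : coalition n) w => v t w S))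
  (* neighbor-graphs and weights *)
  (E : nat -> rel 'I_n.+1) (A : nat -> 'M[R]_n.+1)
  (E_refl : forall t i, E t i i)
  (A_link : forall t i j, E t i j -> 0 < A t i j)
  (A_nolink : forall t i j, ~~ E t i j -> A t i j = 0)
  (* allocations: random initial ones, independent of the game *)
  (x : nat -> 'I_n.+1 -> T -> 'rV[R]_n.+1)
  (x0_random : forall i, random_family (fun k w => x 0%N i w ord0 k))
  (x0_indep : independent_families P
     (fun (ik : 'I_n.+1 * 'I_n.+1) w => x 0%N ik.1 w ord0 ik.2)
     (fun (tS : nat * coalition n) w => v tS.1 w tS.2))
  (* (1) *)
  (vmax : charfun R n)
  (v_grand : forall t w, v t w (grand n) = vmax (grand n))
  (v_le : forall t w (S : coalition n), S != grand n -> v t w S <= vmax S)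
  (* (2) *)
  (core_nonempty : core vmax !=set0)
  (* (3) *)
  (A_stoch : forall t, doubly_stochastic (A t))
  (A_diag : forall t i, 0 < A t i i)
  (alpha : R) (alpha_gt0 : 0 < alpha)
  (A_alpha : forall t i j, 0 < A t i j -> alpha <= A t i j)
  (* (4) *)
  (Q : nat) (Q_ge1 : (1 <= Q)%N)
  (connected : forall t,
     strongly_connected (union_graph E (t * Q) (t.+1 * Q)))
  (* (5) *)
  (v_io : P (lim_sup_set (fun t => [set w | v t w = vmax])) = 1%E)
  (* the bargaining protocol *)
  (protocol : forall t i w,
     x t.+1 i w =
     euclid_proj (bounding_set (v t w) i)
       (\sum_(j < n.+1) A t i j *: x t j w)) :
  exists xt : T -> 'rV[R]_n.+1,
    [/\ random_family (fun k w => xt w ord0 k),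
        forall w, core vmax (xt w) &
        {ae P, forall w, forall i,
          enorm (x t i w - xt w) @[t --> \oo] --> (0 : R)}].
Proof.
have core_bounding t w i z : core vmax z -> bounding_set (v t w) i z.
  by apply: core_sub_bounding_set; [exact: v_grand|exact: v_le].
have [c coc] := core_nonempty.
have mx t : forall i, random_vector (x t i).
  elim: t => [|t IHt] i; first exact: x0_random.
  rewrite (_ : x t.+1 i = fun w => euclid_proj (bounding_set (v t w) i)
       (\sum_(j < n.+1) A t i j *: x t j w)); last first.
    by apply/funext => w; exact: protocol.
  apply: (random_vector_bounding_proj (s := vmax (grand n)) (c := c)) => //.
    by move=> w; exact: core_bounding.
  move=> k; rewrite (_ : (fun _ => _) =
      fun w => \sum_(j < n.+1) A t i j * x t j w ord0 k).
    by apply: measurable_sum => j; apply: measurable_funM => //; exact: IHt.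
  by apply/funext => w; rewrite summxE; apply: eq_bigr => j _; rewrite mxE.
have m_vmax t : measurable [set w | v t w = vmax].
  rewrite (_ : [set w | _] =
      \bigcap_(S in [set: coalition n]) [set w | v t w S = vmax S]).
    apply: fin_bigcap_measurable => [|S _]; first exact: finite_finset.
    rewrite -[X in measurable X]setTI.
    exact: (v_random t S measurableT [set vmax S] (measurable_set1 _)).
  apply/seteqP; split=> w /= vw; first by move=> S _ /=; rewrite vw.
  by apply/ffunP => S; exact: vw.
set io := lim_sup_set _ in v_io.
have m_io : measurable io.
  by apply: bigcap_measurable => // k _; exact: bigcup_measurable.
have cvg_io w : io w -> exists2 l, core vmax l & forall i, x t i w @[t --> \oo] --> l.
  move=> iow; apply: (bargaining_cvg (v := v ^~ w) (E := E) (A := A)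
    (alpha := alpha) (Q := Q) (x := fun t i => x t i w)) => //.
  - by move=> t S; exact: v_le.
  - by move=> t i j /A_link; exact: A_alpha.
  - by move=> k; have [t /= kt vt] := iow k I; exists t.
(* Freezing the sequence at [c] off [io] makes it converge for every outcome, so the limit takes
   values in the core everywhere and is measurable as a pointwise limit, although it is obtained by
   choice. *)
pose h t w := if w \in io then x t ord0 w else c.
have hP w : exists l, [/\ core vmax l, h ^~ w @ \oo --> l &
    io w -> forall i, x t i w @[t --> \oo] --> l].
  have [iow|nio] := pselect (io w).
    have [l col xl] := cvg_io w iow; exists l; split=> //.
    by rewrite /h mem_set//; exact: xl.
  by exists c; split=> //; rewrite /h memNset//; exact: cvg_cst.
have [xt xtP] := choice hP; exists xt; split.
- apply: (random_vector_cvg (h := h)); last by move=> w; have [] := xtP w.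
  move=> t; apply: (random_vector_if _ (mx t ord0) (random_vector_cst c)).
  apply: (measurable_fun_bool true); rewrite setTI.
  rewrite (_ : _ @^-1` _ = io)//.
  by apply/seteqP; split=> w /=; [move/set_mem|move/mem_set].
- by move=> w; have [] := xtP w.
- exists (~` io); split; first exact: measurableC.
    by rewrite probability_setC// v_io subee.
  apply: subsetC => w iow i; have [_ _ /(_ iow i) xl] := xtP w.
  (* Convergence is known in the sup-norm topology; continuity of [sqnorm] and of the square root
     transfers it to [enorm]. *)
  have V0 : sqnorm (x t i w - xt w) @[t --> \oo] --> (0 : R).
    have /cvg_comp := xl; rewrite (_ : 0 = sqnorm (xt w - xt w)); last first.
      by rewrite /sqnorm subrr big1// => k _; rewrite mxE expr0n.
    move=> /(_ _ _ _ (@continuous_sqnormB _ _ (xt w) (xt w))).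
    by apply: cvg_trans; apply: near_eq_cvg; apply: nearW => t; rewrite sqnormBC.
  have := cvg_comp _ _ V0 (@sqrt_continuous R 0).
  by rewrite sqrtr0.
Qed.
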